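(* Let $p$ be a prime number such that $p \equiv -1$ modulo $8$. Then the group $\mathbb{Z}/p\mathbb{Z}$ does not satisfy the acyclic matching property.
   Context: Let $G$ be an abelian group, written additively with neutral element $0$. For finite subsets $A, B$ of $G$, a matching from $A$ to $B$ is a bijection $f : A \to B$ such that $a + f(a) \notin A$ for all $a \in A$. Its multiplicity function $m_f : G \to \mathbb{Z}_{\ge 0}$ is $m_f(x) = |\{a \in A : a + f(a) = x\}|$. A matching $f : A \to B$ is acyclic if for every matching $g : A \to B$, $m_f = m_g$ implies $f = g$. The group $G$ has (satisfies) the acyclic matching property if for every pair of finite subsets $A, B$ of $G$ with $|A| = |B|$ and $0 \notin B$, there is at least one acyclic matching from $A$ to $B$. *)

(* Defs.v *)
From HB Require Import structures.
From mathcomp Require Import all_boot all_algebra finmap.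

Set Implicit Arguments.
Unset Strict Implicit.
Unset Printing Implicit Defensive.

Import GRing.Theory.
Local Open Scope fset_scope.
Local Open Scope ring_scope.

Section Matchings.
Variable G : zmodType.
Implicit Types A B : {fset G}.

(* Bundling maps as {ffun A -> B} rather than as functions on G makes [f = g]   *)
(* equality on A only, with no dependence on values outside A.                 *)
Definition matching A B (f : {ffun A -> B}) : Prop :=
  bijective f /\ forall a : A, val a + val (f a) \notin A.

Definition multiplicity A B (f : {ffun A -> B}) (x : G) : nat :=
  #|[set a : A | val a + val (f a) == x]|.

Definition acyclic_matching A B (f : {ffun A -> B}) : Prop :=
  matching f /\
  forall g : {ffun A -> B},
    matching g -> multiplicity f =1 multiplicity g -> f = g.

End Matchings.

Definition acyclic_matching_property (G : zmodType) : Prop :=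
  forall A B : {fset G},
    #|` A| = #|` B| -> 0 \notin B ->
    exists f : {ffun A -> B}, acyclic_matching f.

(* Main.v *)
Require Import Defs.
From mathcomp Require Import all_boot all_algebra finmap.
From mathcomp Require Import all_fingroup all_solvable zify.

(** By Gauss's lemma [2 ^ ((p - 1) / 2) = 1] modulo [p], and [(p - 1) / 2] is odd,
    so the multiplicative subgroup [H] generated by [2] has odd order. A matching
    [f] from [H] to [H] and its inverse have the
    same multiplicity function, so if [f] is acyclic it is an involution of a set
    of odd size. Hence [f a = a] for some [a], and then [a + f a = 2 a] lies in
    [H], a contradiction. *)

Set Implicit Arguments.
Unset Strict Implicit.
Unset Printing Implicit Defensive.

Import GRing.Theory.
Local Open Scope ring_scope.

(** The permutation given by [f] generates a 2-group, so the number of its fixed points has the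
    parity of [#|T|] and cannot be zero. *)
Lemma involution_fixed_point (T : finType) (f : T -> T) :
  involutive f -> odd #|T| -> exists x, f x = x.
Proof.
move=> ff oddT; pose s := perm (inv_inj ff).
have s2 : (s ^+ 2 = 1)%g.
  by apply/permP => x; rewrite expgS expg1 permM !permE /= ff.
have s_pgroup : (2.-group <[s]>)%g.
  have : (#[s]%g %| 2 ^ 1)%N by rewrite order_dvdn s2.
  by move=> /pnat_dvd; apply; rewrite pnatX pnat_id.
have s_acts : [acts <[s]>%g, on [set: T] | 'P].
  by apply/actsP => u _ x; rewrite !inE.
have := pgroup_fix_mod s_pgroup s_acts; rewrite cardsT !modn2 oddT.
case: (set_0Vmem ('Fix_([set: T] | 'P)(<[s]>))%g) => [-> | [x]].
  by rewrite cards0.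
rewrite inE => /andP[_ /afixP fix_x] _; exists x.
by have := fix_x s (cycle_id s); rewrite /= apermE permE.
Qed.

(** Separates the factors that Gauss's lemma keeps as even numbers from the odd ones, which it
    recovers up to sign. *)
Lemma fact_prod_even_odd (s : nat) :
  ((2 * s).+1`! =
    (\prod_(k < s) (2 * k.+1)) * \prod_(k < s.+1) (2 * k).+1)%N.
Proof.
elim: s => [|s IHs]; first by rewrite big_ord0 big_ord_recr big_ord0.
rewrite mulnS 2!addSn add0n 2!factS IHs [in RHS]big_ord_recr /=.
by rewrite [(\prod_(k < s.+2) _)%N]big_ord_recr /=; lia.
Qed.

(* Gauss's lemma: in the product of the [2 k] for [1 <= k <= 2 s + 1], the
   factors with [k > s] are the opposites of the odd numbers up to [2 s + 1]. *)
Lemma exp2_half_Zp (s : nat) (p_prime : prime (4 * s + 3)) :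
  (2 : 'Z_(4 * s + 3)) ^+ (2 * s).+1 = (-1) ^+ s.+1.
Proof.
set p := (4 * s + 3)%N in p_prime *.
have p_gt1 := prime_gt1 p_prime.
(* All factors are at most [2 s + 1 < p], so the factorial can be cancelled. *)
have fact_unit : ((2 * s).+1`!%:R : 'Z_p) \is a GRing.unit.
  rewrite unitZpE // prime_coprime // fact_prod big_nat.
  apply: (big_rec (fun m => ~~ (p %| m)%N)).
    by rewrite dvdn1 neq_ltn p_gt1 orbT.
  move=> i m /andP[i_gt0 lt_i] ndvd_m; rewrite Euclid_dvdM // negb_or ndvd_m.
  by rewrite gtnNdvd // /p; lia.
apply: (mulIr fact_unit).
transitivity (\prod_(k < (2 * s).+1) (2 * k.+1)%:R : 'Z_p).
  rewrite fact_prod big_add1 /= big_mkord natr_prod.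
  under [in RHS]eq_bigr do rewrite natrM.
  by rewrite big_split /= prodr_const card_ord.
rewrite -(big_mkord xpredT (fun k => (2 * k.+1)%:R)).
rewrite (big_cat_nat (n := s)) //=; last by lia.
rewrite big_mkord -[X in \prod_(X <= _ < _) _]add0n big_addn.
rewrite (_ : (2 * s).+1 - s = s.+1)%N; last by lia.
(* Replacing [k] by [s - k] turns the factor into [2 (2 s - k + 1) = p - (2 k + 1)]. *)
rewrite big_mkord [\prod_(k < s.+1) _](reindex_inj rev_ord_inj) /=.
rewrite fact_prod_even_odd natrM !natr_prod mulrCA; congr (_ * _).
transitivity (\prod_(k < s.+1) - ((2 * k).+1%:R : 'Z_p)); last first.
  by rewrite prodrN card_ord.
apply: eq_bigr => -[k /= lt_k] _; apply/eqP.
rewrite -addr_eq0 -natrD.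
rewrite (_ : 2 * (s.+1 - k.+1 + s).+1 + (2 * k).+1 = p)%N; last by rewrite /p; lia.
by rewrite pchar_Zp.
Qed.

Section SelfMatching.
Variables (G : zmodType) (A : {fset G}).

(** For [b = f a], commutativity gives [a + f a = b + g b], so [f] maps the fibre over each sum [x]
    for [f] onto that for [g]. *)
Lemma matching_inverse (f g : {ffun A -> A}) :
  cancel f g -> cancel g f -> matching f ->
  matching g /\ multiplicity f =1 multiplicity g.
Proof.
move=> fK gK [_ fA]; split.
  split; first by exists f.
  by move=> b; rewrite addrC -{2}(gK b) fA.
move=> x; rewrite /multiplicity -(card_imset _ (can_inj fK)).
apply: eq_card => b; rewrite inE; apply/imsetP/idP.
  by case=> a; rewrite inE => /eqP <- ->; rewrite fK addrC.
by move=> /eqP <-; exists (g b); rewrite ?inE gK // addrC.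
Qed.

Lemma acyclic_self_matching_involutive (f : {ffun A -> A}) :
  acyclic_matching f -> involutive f.
Proof.
case=> f_match f_acyclic; have [[g fK gK] _] := f_match.
have fK' : cancel f (finfun g) by move=> a; rewrite ffunE fK.
have gK' : cancel (finfun g) f by move=> a; rewrite ffunE gK.
have [g_match eq_mul] := matching_inverse fK' gK' f_match.
by move=> a; rewrite {1}(f_acyclic _ g_match eq_mul) fK'.
Qed.

Lemma no_acyclic_self_matching (f : {ffun A -> A}) :
  odd #|` A|%fset -> (forall a, a \in A -> a + a \in A) -> ~ acyclic_matching f.
Proof.
move=> oddA doubleA f_acyclic; rewrite cardfE in oddA.
have f_invol := acyclic_self_matching_involutive f_acyclic.
have [a fa] := involution_fixed_point f_invol oddA.
case: f_acyclic => -[_ /(_ a)]; rewrite fa => /negP notA _.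
by apply/notA/doubleA/valP.
Qed.

End SelfMatching.

Theorem proposition2p2 (p : nat) (p_prime : prime p)
    (p_mod8 : (p%:Z = -1 %[mod 8])%Z) :
  ~ acyclic_matching_property 'Z_p.
Proof.
(* Since [p] is 7 modulo 8, [s] is odd, which makes the sign [(-1) ^ (s + 1)] in Gauss's lemma equal
   to 1. *)
have [s odd_s def_p] : exists2 s, odd s & p = (4 * s + 3)%N.
  by exists (p %/ 4)%N; lia.
subst p; set p := (4 * s + 3)%N in p_prime p_mod8 *.
have p_gt1 := prime_gt1 p_prime.
have exp2 : (2 : 'Z_p) ^+ (2 * s).+1 = 1.
  by rewrite exp2_half_Zp // -signr_odd /= odd_s expr0.
have unit2 : (2 : 'Z_p) \is a GRing.unit.
  by rewrite -(unitrX_pos _ (ltn0Sn (2 * s))) exp2 unitr1.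
pose u : {unit 'Z_p} := FinRing.unit 'Z_p unit2.
have odd_u : odd #[u]%g.
  have : (#[u]%g %| (2 * s).+1)%N.
    by rewrite order_dvdn -val_eqE /= FinRing.val_unitX /= exp2.
  by move/dvdn_odd; apply; rewrite /= oddM.
(* The subgroup [H] is formed among the units and then viewed as a set of residues, so it avoids
   0. *)
pose A : {fset 'Z_p} := [fset val v | v in <[u]>%g]%fset.
move=> /(_ A A erefl)[|f].
  apply/imfsetP => -[v _ v0]; have := valP v.
  by rewrite -v0 unitr0.
apply: no_acyclic_self_matching.
  by rewrite card_imfset /=; [rewrite -cardE | exact: val_inj].
move=> a /imfsetP[v /= vu ->]; apply/imfsetP; exists (u * v)%g => /=.
  by rewrite groupM // cycle_id.
by rewrite mulr_natl mulr2n.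
Qed.
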